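(* Let $(G,L,v)$ be a reachable triple, $i\in[4]$ a color and $D\ge2$ an integer. Then: (1) $P(G,L,v,i,D)=0$ if and only if $\Pr_{G,L}[c(v)=i]=0$; (2) $P(G,L,v,i,D)=\frac12$ if and only if $\Pr_{G,L}[c(v)=i]=\frac12$; (3) $P(G,L,v,i,D)\in[\frac1{13},\frac{13}{27}]$ if and only if $\Pr_{G,L}[c(v)=i]\in[\frac1{13},\frac{13}{27}]$.
   Context: Colors are $[4]=\{1,2,3,4\}$. A list-coloring instance $(G,L)$ is a finite simple graph $G=(V,E)$ with $L:V\to 2^{[4]}$; a proper coloring is $c:V\to[4]$ with $c(u)\in L(u)$ for all $u$ and $c(u)\ne c(w)$ on every edge; $\Pr_{G,L}[c(v)=i]$ is the probability that $c(v)=i$ for $c$ uniform over proper colorings of $(G,L)$. For a vertex $v$, $G_v$ is $G$ with $v$ and its incident edges removed, and $G_{v,w}=(G_v)_w$. If $v$ has neighbors $v_1,\dots,v_d$ (in a fixed order), then for $k\in[d]$ and a color $j$, $L_{k,j}$ is the list assignment on $G_v$ with $L_{k,j}(v_\ell)=L(v_\ell)\setminus\{j\}$ for $\ell<k$ and $L_{k,j}(u)=L(u)$ for all other vertices $u$ (so $L_{1,j}=L$). A triple $(G,L,v)$ with $v\in V$ is reachable if $\deg_G(u)\le3$ and $|L(u)|\ge\deg_G(u)+1$ for every $u\in V$, and moreover $\deg_G(v)\le2$ and $|L(v)|\ge\deg_G(v)+2$. The procedure $P(G,L,v,i,D)$ ($i\in[4]$, $D$ an integer) is defined recursively (empty products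 equal $1$): (a) If $i\notin L(v)$, return $0$. Otherwise, if $D\le 0$ or $\deg_G(v)=0$, return $1/|L(v)|$. (b) If $\deg_G(v)=1$ with neighbor $v_1$: let $x=P(G_v,L,v_1,i,D-1)$. If $|L(v)|=2$, say $L(v)=\{i,j\}$, let $y=P(G_v,L,v_1,j,D-1)$ and return $\frac{1-x}{2-x-y}$. If $|L(v)|=4$, return $\frac{1-x}{3}$. If $|L(v)|=3$, let $j$ be the unique color in $[4]\setminus L(v)$, $y=P(G_v,L,v_1,j,D-1)$, and return $\frac{1-x}{2+y}$. (c) If $\deg_G(v)=2$: order its neighbors $v_1,v_2$ so that $\deg_G(v_1)\ge\deg_G(v_2)$ and, if $\deg_G(v_1)=\deg_G(v_2)=1$, so that $i\notin L(v_1)$ implies $i\notin L(v_2)$. Let $u_1,\dots,u_{d_1}$ be the neighbors of $v_1$ in $G_v$ (fixed order) and for $k\in[d_1]$, $w\in[4]$ let $L'_{k,w}$ be the list assignment on $G_{v,v_1}$ with $L'_{k,w}(u_\ell)=L(u_\ell)\setminus\{w\}$ for $\ell<k$ and $L'_{k,w}(u)=L(u)$ otherwise. Set $x_{k,w}=P(G_{v,v_1},L'_{k,w},u_k,w,D-1)$ for $k\in[d_1]$, $w\in L(v_1)$. For $j\in L(v)$ set $f_j=0$ if $j\notin L(v_1)$ and otherwise $f_j=\frac{\prod_{k=1}^{d_1}(1-x_{k,j})}{\sum_{w\in L(v_1)}\prod_{k=1}^{d_1}(1-x_{k,w})}$, and set $y_j=P(G_v,L_{2,j},v_2,j,D-1)$.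 Return $\frac{(1-f_i)(1-y_i)}{\sum_{j\in L(v)}(1-f_j)(1-y_j)}$. (d) If $\deg_G(v)=3$ with neighbors $v_1,v_2,v_3$: for $j\in L(v)$ let $x_j=P(G_v,L_{1,j},v_1,j,D-1)$, $y_j=P(G_v,L_{2,j},v_2,j,D-1)$, $z_j=P(G_v,L_{3,j},v_3,j,D-1)$, and return $\frac{(1-x_i)(1-y_i)(1-z_i)}{\sum_{j\in L(v)}(1-x_j)(1-y_j)(1-z_j)}$. For reachable triples, all recursive calls are again on reachable triples and case (d) never occurs. *)

(* Defs.v *)
(* Colors [4] = {1,2,3,4} are represented by 'I_4 = {0,1,2,3}. *)
From HB Require Import structures.
From mathcomp Require Import all_boot all_order all_algebra.
Set Implicit Arguments. Unset Strict Implicit. Unset Printing Implicit Defensive.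
Import Order.TTheory GRing.Theory Num.Theory.
Local Open Scope ring_scope.

Section ListColoring.
Variable T : finType.
(* the (global) simple graph: symmetric irreflexive edge relation on T;
   an induced subgraph is given by its vertex set S : {set T}. *)
Variable e : rel T.

Definition nbrs (S : {set T}) (u : T) : seq T :=
  [seq w <- enum T | (w \in S) && e u w].

Definition deg (S : {set T}) (u : T) : nat := #|[set w in S | e u w]|.

Definition remk (L : T -> {set 'I_4}) (s : seq T) (k : nat) (j : 'I_4)
  : T -> {set 'I_4} :=
  fun u => if u \in take k s then L u :\ j else L u.

Definition order2 (S : {set T}) (L : T -> {set 'I_4}) (i : 'I_4) (a b : T)
  : T * T :=
  if (deg S b <= deg S a)%N &&
     ((deg S a == 1%N) && (deg S b == 1%N) ==> ((i \notin L a) ==> (i \notin L b)))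
  then (a, b) else (b, a).

Definition other (A : {set 'I_4}) (i : 'I_4) : 'I_4 :=
  odflt i [pick j in A :\ i].

(* The procedure P(G,L,v,i,D), with G the subgraph induced on S.
   D : nat ; D = 0 is the base case D <= 0. Cases that cannot arise for
   reachable triples (deg >= 4, or |L v| not in {2,3,4} when deg = 1) return
   the value 1/|L v| (irrelevant). *)
Fixpoint P (D : nat) (S : {set T}) (L : T -> {set 'I_4}) (v : T) (i : 'I_4)
  {struct D} : rat :=
  if i \notin L v then 0 else
  match D with
  | 0%N => (#|L v|%:R)^-1
  | D'.+1 =>
    let Sv := S :\ v in
    match nbrs S v with
    | [:: v1] =>
        let x := P D' Sv L v1 i in
        if #|L v| == 2%N then
          let y := P D' Sv L v1 (other (L v) i) in (1 - x) / (2 - x - y)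
        else if #|L v| == 4%N then (1 - x) / 3
        else if #|L v| == 3%N then
          let y := P D' Sv L v1 (other (~: L v) i) in (1 - x) / (2 + y)
        else (#|L v|%:R)^-1
    | [:: a; b] =>
        let v1 := (order2 S L i a b).1 in
        let v2 := (order2 S L i a b).2 in
        let us := nbrs Sv v1 in
        let Svv1 := Sv :\ v1 in
        let pr (w : 'I_4) : rat :=
          \prod_(k < size us) (1 - P D' Svv1 (remk L us k w) (nth v us k) w) in
        let f (j : 'I_4) : rat :=
          if j \in L v1 then pr j / \sum_(w in L v1) pr w else 0 in
        let y (j : 'I_4) : rat := P D' Sv (remk L [:: v1; v2] 1 j) v2 j in
        (1 - f i) * (1 - y i) / \sum_(j in L v) (1 - f j) * (1 - y j)
    | [:: v1; v2; v3] =>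
        let s := [:: v1; v2; v3] in
        let t (j : 'I_4) : rat :=
          (1 - P D' Sv (remk L s 0 j) v1 j) * (1 - P D' Sv (remk L s 1 j) v2 j)
          * (1 - P D' Sv (remk L s 2 j) v3 j) in
        t i / \sum_(j in L v) t j
    | _ => (#|L v|%:R)^-1
    end
  end.

Definition proper_col (L : T -> {set 'I_4}) (c : {ffun T -> 'I_4}) : bool :=
  [forall u, c u \in L u] && [forall u, forall w, e u w ==> (c u != c w)].

Definition Pr (L : T -> {set 'I_4}) (v : T) (i : 'I_4) : rat :=
  #|[set c | proper_col L c & c v == i]|%:R / #|[set c | proper_col L c]|%:R.

Definition reachable (L : T -> {set 'I_4}) (v : T) : Prop :=
  (forall u, (deg setT u <= 3)%N /\ (deg setT u + 1 <= #|L u|)%N) /\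
  (deg setT v <= 2)%N /\ (deg setT v + 2 <= #|L v|)%N.

End ListColoring.

(* Main.v *)
(* Colorings of an induced subgraph [S] satisfy exactly the recursion computed by
   the procedure, so the procedure is exact as soon as its depth is at least
   [#|S|].  Hence it suffices to show that, for a fixed reachable triple and color,
   the outputs at depths [D >= 2] are all [0], or all [1/2], or all in
   [[1/13, 13/27]].  Every output is at most [1/2], and at least [1/13] when the
   color is allowed; since the values at a vertex sum to [1], the recursion
   preserves these bounds.  The value is [0] only for a forbidden color, and [1/2]
   only in three rigid configurations around [v]: an isolated vertex with two
   colors, a vertex with three colors whose neighbour avoids both [i] and the
   missing color, and a triangle whose two other vertices avoid [i].  In all other
   cases the bound [1/13] on some neighbouring value pushes the value down to
   [13/27]. *)

Require Import Defs.
From HB Require Import structures.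
From mathcomp Require Import all_boot all_order all_algebra.
From mathcomp Require Import zify lra.
Import Order.TTheory GRing.Theory Num.Theory.
Local Open Scope ring_scope.

(* Elaborating [{set (ordinal 4)}] leaves [reverse_coercion] marks in cardinals,
   which make convertible atoms look different to [lia]. *)
Local Ltac nlia := unfold reverse_coercion in *; lia.

(** * Bounds on normalized weights over four colors *)

Section Normalized.
Implicit Types (A : {set 'I_4}) (f g y : 'I_4 -> rat) (i j : 'I_4).

(** The value is 0 outside [A], so a distribution on a list can be summed over all four colors. *)
Definition normalized A g j : rat :=
  if j \in A then g j / \sum_(w in A) g w else 0.

Lemma eq_normalized A g g' : g =1 g' -> normalized A g =1 normalized A g'.
Proof.
move=> E j; rewrite /normalized E; case: ifP => // _.
by congr (_ / _); apply: eq_bigr.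
Qed.

Lemma sum_normalized A g : \sum_(w in A) g w != 0 -> \sum_j normalized A g j = 1.
Proof.
move=> g0; rewrite -big_mkcond /= -mulr_suml; exact: divff.
Qed.

Lemma sum_compl_in A f :
  \sum_(j in A) (1 - f j) = #|A|%:R - \sum_(j in A) f j.
Proof. by rewrite big_split /= sumr_const sumrN. Qed.

(** Mass at most 1 lies in [A], which leaves at least [#|A| - 1]; over all four colors the
    complements add up to 4 - 1. *)
Lemma sum_compl_bounds A f : (forall j, 0 <= f j <= 1 / 2) -> \sum_j f j = 1 ->
  (3 <= #|A|)%N -> 2 <= \sum_(j in A) (1 - f j) <= 3.
Proof.
move=> f01 f1 A3; apply/andP; split.
  have A3r : 3 <= #|A|%:R :> rat by rewrite (ler_nat _ 3).
  have : \sum_(j in A) f j <= 1.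
    by rewrite -f1 [leRHS](bigID (mem A)) /= lerDl sumr_ge0 // => j _; case/andP: (f01 j).
  by rewrite sum_compl_in; lra.
have -> : 3 = \sum_j (1 - f j) by rewrite sumrB f1 sumr_const card_ord.
rewrite [leRHS](bigID (mem A)) /= lerDl sumr_ge0 // => j _.
by have := f01 j; lra.
Qed.

(** The numerator lies in [1/2, 1] and the denominator in [2, 3]. *)
Lemma normalized1_bounds A f i : (forall j, 0 <= f j <= 1 / 2) ->
  \sum_j f j = 1 -> (3 <= #|A|)%N -> i \in A ->
  1 / 6 <= normalized A (fun j => 1 - f j) i <= 1 / 2.
Proof.
move=> f01 f1 A3 iA; rewrite /normalized iA.
have := sum_compl_bounds A f f01 f1 A3; set s := \sum_(_ in _) _ => /andP[s2 s3].
have fi := f01 i; rewrite ler_pdivlMr ?ler_pdivrMr; [|lra|lra].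
by apply/andP; split; lra.
Qed.

(** Termwise, the two sides differ by (1/2 - f j)(1/2 - y j), which is nonnegative. Only [f] is
    assumed to sum to 1: in the recursion the values [y j] come from list assignments that vary with
    [j]. The last sum is the deficit of [y] below 1/2. *)
Lemma sum_prod_ge f y i : (forall j, 0 <= f j <= 1 / 2) ->
  (forall j, 0 <= y j <= 1 / 2) -> \sum_j f j = 1 ->
  1 + f i / 2 + 1 / 2 * \sum_(j | j != i) (1 / 2 - y j) <=
    \sum_(j | j != i) (1 - f j) * (1 - y j).
Proof.
move=> f01 y01; rewrite (bigD1 i) //= => f1.
have c3 : \sum_(j | j != i) 1 = 3 :> rat by rewrite sumr_const cardC1 card_ord.
have -> : 1 + f i / 2 + 1 / 2 * \sum_(j | j != i) (1 / 2 - y j) =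
    \sum_(j | j != i) (1 / 2 * (1 - f j) + 1 / 2 * (1 / 2 - y j)).
  have sf : \sum_(j | j != i) (1 - f j) = 3 - \sum_(j | j != i) f j by rewrite sumrB c3.
  by rewrite [RHS]big_split /= -!mulr_sumr sf; lra.
apply: ler_sum => j _; have := f01 j; have := y01 j => /andP[_ hy] /andP[_ hf].
by nra.
Qed.

Lemma deficit_ge0 y i : (forall j, 0 <= y j <= 1 / 2) ->
  0 <= \sum_(j | j != i) (1 / 2 - y j).
Proof. by move=> y01; apply: sumr_ge0 => j _; have := y01 j; lra. Qed.

Lemma sum_prod_le f y i : (forall j, 0 <= f j <= 1 / 2) ->
  (forall j, 0 <= y j <= 1 / 2) -> \sum_(j | j != i) (1 - f j) * (1 - y j) <= 3.
Proof.
move=> f01 y01.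
have -> : 3 = \sum_(j | j != i) (1 : rat) by rewrite sumr_const cardC1 card_ord.
by apply: ler_sum => j _; have := f01 j; have := y01 j; nra.
Qed.

(** The weight n of [i] lies in [1/4, 1] and the other three weights total s in [1, 3]. Hence n / (n
    + s) is at least (1/4) / (1/4 + 3) = 1/13 and at most 1/2. *)
Lemma normalized2_bounds A f y i : (forall j, 0 <= f j <= 1 / 2) ->
  (forall j, 0 <= y j <= 1 / 2) -> \sum_j f j = 1 -> A = setT ->
  1 / 13 <= normalized A (fun j => (1 - f j) * (1 - y j)) i <= 1 / 2.
Proof.
move=> f01 y01 f1 ->; rewrite /normalized inE.
rewrite (eq_bigl predT) => [|j]; last by rewrite inE.
rewrite (bigD1 i) //=.
have := sum_prod_ge f y i f01 y01 f1; have := deficit_ge0 y i y01.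
have := sum_prod_le f y i f01 y01.
move: (f01 i) (y01 i); set s := \sum_(_ | _) _ * _; set d := \sum_(_ | _) _.
move: (f i) (y i) => a b /andP[a0 a1] /andP[b0 b1] s3 d0 ds.
have n1 : 1 / 4 <= (1 - a) * (1 - b) by nra.
have n2 : (1 - a) * (1 - b) <= 1 by nra.
by rewrite ler_pdivlMr ?ler_pdivrMr; [apply/andP; split; lra|lra|lra].
Qed.

(** The bound amounts to 14 n <= 13 s. Either of the first two alternatives gives n <= 12/13 with s
    >= 1; the third gives s >= 14/13 with n <= 1. *)
Lemma normalized2_le A f y i : (forall j, 0 <= f j <= 1 / 2) ->
  (forall j, 0 <= y j <= 1 / 2) -> \sum_j f j = 1 -> A = setT ->
  [\/ 1 / 13 <= f i, 1 / 13 <= y i |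
      2 / 13 <= \sum_(j | j != i) (1 / 2 - y j)] ->
  normalized A (fun j => (1 - f j) * (1 - y j)) i <= 13 / 27.
Proof.
move=> f01 y01 f1 -> H; rewrite /normalized inE.
rewrite (eq_bigl predT) => [|j]; last by rewrite inE.
rewrite (bigD1 i) //=.
have := sum_prod_ge f y i f01 y01 f1; have := deficit_ge0 y i y01.
move: (f01 i) (y01 i) H; set s := \sum_(_ | _) _ * _; set d := \sum_(_ | _) _.
move: (f i) (y i) => a b /andP[a0 a1] /andP[b0 b1] H d0 ds.
have n1 : 1 / 4 <= (1 - a) * (1 - b) by nra.
rewrite ler_pdivrMr; last lra.
have na : (1 - a) * (1 - b) <= 1 - a by nra.
have nb : (1 - a) * (1 - b) <= 1 - b by nra.
by case: H => H; lra.
Qed.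

End Normalized.

(** * Reachability in induced subgraphs *)

Section Procedure.
Context {T : finType} {e : rel T} (esym : symmetric e) (eirr : irreflexive e).
Implicit Types (S : {set T}) (L : T -> {set 'I_4}) (u v w : T) (i j : 'I_4).

Local Notation P := (P e).
Local Notation nbrs := (nbrs e).
Local Notation deg := (deg e).

Definition list_ok S L :=
  forall u, u \in S -> (deg S u <= 3)%N /\ (deg S u < #|L u|)%N.

Definition reachable_in S L v :=
  [/\ list_ok S L, v \in S, (deg S v <= 2)%N & (deg S v + 2 <= #|L v|)%N].

Lemma mem_nbrs S u w : (w \in nbrs S u) = (w \in S) && e u w.
Proof. by rewrite mem_filter mem_enum andbT. Qed.

Lemma nbrs_uniq S u : uniq (nbrs S u).
Proof. exact: filter_uniq (enum_uniq _). Qed.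

Lemma size_nbrs S u : size (nbrs S u) = deg S u.
Proof.
rewrite /deg cardE; apply/perm_size/uniq_perm; rewrite ?enum_uniq ?nbrs_uniq //.
by move=> w; rewrite mem_nbrs mem_enum inE.
Qed.

Lemma deg_rem S v u : v \in S -> deg S u = (e u v + deg (S :\ v) u)%N.
Proof.
move=> vS; rewrite /deg (cardsD1 v) !inE vS /=; congr (_ + _)%N.
by apply: eq_card => w; rewrite !inE andbA.
Qed.

Lemma card_list_le L u : (#|L u| <= 4)%N.
Proof. by rewrite -[X in (_ <= X)%N](card_ord 4) max_card. Qed.

Lemma list_ok_rem S L v s k j :
  list_ok S L -> v \in S -> {subset s <= nbrs S v} ->
  list_ok (S :\ v) (remk L s k j).
Proof.
move=> ok vS sub u; rewrite !inE => /andP[uv uS]; have [d3 dL] := ok _ uS.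
have dE := deg_rem S v u vS; split; first nlia.
rewrite /remk; case: ifPn => [us|_]; last nlia.
have := sub _ (mem_take us); rewrite mem_nbrs esym => /andP[_ euv].
rewrite euv in dE; move: dL; rewrite (cardsD1 j); case: (j \in L u) => /=; nlia.
Qed.

(** Deleting [v] lowers the degree of its [k]-th neighbour by one, while only the lists of earlier
    neighbours are cut; this creates the extra slack demanded at the root. *)
Lemma reachable_in_rem S L v x0 s k j :
  list_ok S L -> v \in S -> uniq s -> {subset s <= nbrs S v} ->
  (k < size s)%N -> reachable_in (S :\ v) (remk L s k j) (nth x0 s k).
Proof.
move=> ok vS us sub ks; set w := nth x0 s k.
have : w \in nbrs S v by apply/sub/mem_nth.
rewrite mem_nbrs => /andP[wS evw]; have [d3 dL] := ok _ wS.
have dE := deg_rem S v w vS; rewrite esym evw in dE.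
split; [exact: list_ok_rem| |nlia|].
  by rewrite !inE wS andbT; apply: contraTneq evw => ->; rewrite eirr.
rewrite /remk (_ : w \in take k s = false); first nlia.
by rewrite in_take ?mem_nth // /w index_uniq // ltnn.
Qed.

Lemma reachable_in_nbr S L v w :
  list_ok S L -> v \in S -> w \in nbrs S v -> reachable_in (S :\ v) L w.
Proof.
move=> ok vS wv.
apply: (@reachable_in_rem S L v v [:: w] 0 ord0) => // u.
by rewrite inE => /eqP->.
Qed.

(** * Counting colorings and the exact recursion *)

(** Colorings take the dummy value [ord0] off [S], so each coloring of the induced subgraph is
    counted exactly once. *)
Definition colorings S L : {set {ffun T -> 'I_4}} :=
  [set c : {ffun T -> 'I_4} | [forall u, if u \in S then c u \in L u else c u == ord0] &&
     [forall u in S, forall w in S, e u w ==> (c u != c w)]].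

Lemma coloringsP S L (c : {ffun T -> 'I_4}) :
  reflect [/\ forall u, u \in S -> c u \in L u,
              forall u, u \notin S -> c u = ord0
            & forall u w, u \in S -> w \in S -> e u w -> c u != c w]
          (c \in colorings S L).
Proof.
rewrite inE; apply: (iffP andP) => [[/forallP h1 /forall_inP h2]|[h1 h2 h3]].
  split=> [u uS|u uS|u w uS wS euw]; try by move: (h1 u); rewrite ?uS ?(negPf uS) // => /eqP.
  by move/forall_inP: (h2 u uS) => /(_ w wS)/implyP; apply.
split; first by apply/forallP => u; case: ifPn => [/h1|/h2/eqP].
apply/forall_inP => u uS; apply/forall_inP => w wS; apply/implyP; exact: h3.
Qed.

Definition fixed_colorings S L v i :=
  [set c : {ffun T -> 'I_4} in colorings S L | c v == i].

(** Forgetting the color of [v] is a bijection. The list [s] may enumerate the neighbours in any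
    order, since the procedure may reorder them. *)
Lemma card_fixed_colorings S L v s i :
  v \in S -> s =i nbrs S v -> i \in L v ->
  #|fixed_colorings S L v i| = #|colorings (S :\ v) (remk L s (size s) i)|.
Proof.
move=> vS sN iL.
pose h (a : 'I_4) (c : {ffun T -> 'I_4}) := [ffun u => if u == v then a else c u].
rewrite -(@card_in_imset _ _ (h ord0)) => [|c d]; last first.
  rewrite !inE => /andP[_ /eqP cv] /andP[_ /eqP dv] /ffunP hcd.
  apply/ffunP => u; have := hcd u; rewrite !ffunE; case: eqP => [->|//].
  by rewrite cv dv.
apply: eq_card => c; apply/imsetP/coloringsP => [[d]|[h1 h2 h3]].
  rewrite inE => /andP[/coloringsP[h1 h2 h3] /eqP dv] ->; split=> [u|u|u w].
  - rewrite !inE ffunE => /andP[uv uS]; rewrite (negPf uv).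
    rewrite /remk take_size; case: ifPn; last by rewrite h1.
    rewrite sN mem_nbrs => /andP[_ evu]; rewrite !inE h1 // andbT -dv eq_sym.
    exact: h3.
  - rewrite !inE ffunE; case: eqP => //= _; exact: h2.
  - rewrite !inE !ffunE => /andP[/negPf-> uS] /andP[/negPf-> wS]; exact: h3.
have L1 u : u \in S -> u != v -> c u \in L u.
  move=> uS uv; have := h1 u; rewrite !inE uv uS /remk => /(_ isT).
  by case: ifP => // _; rewrite inE => /andP[].
have L2 u : u \in S -> e v u -> c u != i.
  move=> uS evu; have uv : u != v by apply: contraTneq evu => ->; rewrite eirr.
  have := h1 u; rewrite !inE uv uS /remk take_size sN mem_nbrs uS evu => /(_ isT).
  by rewrite !inE => /andP[].
exists (h i c); last first.
  apply/ffunP => u; rewrite !ffunE; case: (u =P v) => [->|//].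
  by rewrite h2 // !inE eqxx.
rewrite inE ffunE !eqxx andbT; apply/coloringsP; split=> [u|u|u w].
- by rewrite ffunE; case: eqP => [->|/eqP uv] // uS; apply: L1.
- rewrite ffunE; case: eqP => [->|/eqP uv uS]; first by rewrite vS.
  by apply: h2; rewrite !inE uv.
- rewrite !ffunE; case: (u =P v) => [->|/eqP uv]; case: (w =P v) => [->|/eqP wv] uS wS euw.
  + by rewrite eirr in euw.
  + by rewrite eq_sym L2.
  + by rewrite L2 // esym.
  + by apply: h3; rewrite ?inE ?uv ?wv.
Qed.

Lemma colorings_gt0 S L : list_ok S L -> (0 < #|colorings S L|)%N.
Proof.
have [n] := ubnP #|S|; elim: n => // n IH in S L *.
rewrite ltnS => Sn ok; have [S0|[v vS]] := set_0Vmem S.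
  apply/card_gt0P; exists [ffun=> ord0]; apply/coloringsP; rewrite S0.
  by split=> [u|u|u w]; rewrite ?inE ?ffunE.
have [_ dL] := ok v vS.
have /card_gt0P[i iL] : (0 < #|L v|)%N by nlia.
have : (0 < #|fixed_colorings S L v i|)%N.
  rewrite (@card_fixed_colorings _ _ _ (nbrs S v)) //.
  apply: IH; last exact: list_ok_rem.
  by move: Sn; rewrite (cardsD1 v) vS.
by move/leq_trans; apply; apply/subset_leq_card/subsetP => c; rewrite inE => /andP[].
Qed.

(** Colorings are split by whether the [k]-th vertex of [s] uses [j]; avoiding it amounts to
    removing [j] from one more list. *)
Lemma card_colorings_rem S L s k j x0 :
  uniq s -> {subset s <= S} -> (k < size s)%N ->
  (#|colorings S (remk L s k.+1 j)| +
   #|fixed_colorings S (remk L s k j) (nth x0 s k) j|)%N =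
  #|colorings S (remk L s k j)|.
Proof.
move=> us sS ks; set w := nth x0 s k.
have wS : w \in S by apply/sS/mem_nth.
have wk : w \notin take k s by rewrite in_take ?mem_nth // /w index_uniq // ltnn.
rewrite -(cardsID [set c : {ffun T -> 'I_4} | c w == j] (colorings S (remk L s k j))) addnC.
congr (_ + _)%N; apply: eq_card => c; first by rewrite !inE.
rewrite in_setD; apply/coloringsP/andP => [[h1 h2 h3]|].
  have /andP[cw _] : (c w != j) && (c w \in L w).
    by have := h1 w wS; rewrite {1}/remk (take_nth x0) // mem_rcons inE eqxx !inE.
  split; first by rewrite inE.
  apply/coloringsP; split=> // u uS; have := h1 u uS.
  rewrite /remk (take_nth x0) // mem_rcons inE; case: (u \in take _ _); rewrite ?orbT ?orbF //.
  by case: eqP => // ->; rewrite inE => /andP[].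
rewrite inE => -[cw /coloringsP[h1 h2 h3]]; split=> // u uS; have := h1 u uS.
rewrite /remk (take_nth x0) // mem_rcons inE; case: (u \in take _ _); rewrite ?orbT ?orbF //.
by case: eqP => // -> ?; rewrite !inE cw.
Qed.

Definition PrS S L v i : rat :=
  #|fixed_colorings S L v i|%:R / #|colorings S L|%:R.

Lemma PrST L v i : PrS setT L v i = Pr e L v i.
Proof.
have colT : colorings setT L =i proper_col e L.
  move=> c; apply/coloringsP/andP => [[h1 _ h3]|[/forallP h1 /forallP h2]].
    split; first by apply/forallP => u; apply: h1.
    by apply/forallP => u; apply/forallP => w; apply/implyP; apply: h3.
  split=> // [u|u w _ _ euw]; first by rewrite inE.
  by move/forallP: (h2 u) => /(_ w)/implyP; apply.
rewrite /PrS /Pr; congr (_%:R / _%:R); apply: eq_card => c; last by rewrite colT inE.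
by rewrite [LHS]in_set colT [RHS]in_set.
Qed.

Lemma PrS_notin S L v i : v \in S -> i \notin L v -> PrS S L v i = 0.
Proof.
move=> vS iL; rewrite /PrS (_ : fixed_colorings S L v i = set0) ?cards0 ?mul0r //.
apply/setP => c; rewrite in_set in_set0; apply/negP => /andP[cS /eqP cv].
by case/coloringsP: cS => /(_ v vS); rewrite cv (negPf iL).
Qed.

(* Telescoping: [N (S \ v, L with w removed at the neighbours of v)] divided by
   [N (S \ v, L)] is the product of the probabilities that each neighbour in
   turn avoids [w]. *)
Lemma PrS_rec S L v x0 s i :
  list_ok S L -> v \in S -> uniq s -> s =i nbrs S v -> i \in L v ->
  let pr (w : 'I_4) := \prod_(k < size s) (1 - PrS (S :\ v) (remk L s k w) (nth x0 s k) w) in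
  PrS S L v i = pr i / \sum_(w in L v) pr w.
Proof.
move=> ok vS us sN iL pr.
have sub : {subset s <= nbrs S v} by move=> u; rewrite sN.
have subS : {subset s <= S :\ v}.
  move=> u; rewrite sN mem_nbrs !inE => /andP[-> evu]; rewrite andbT.
  by apply: contraTneq evu => ->; rewrite eirr.
have N_neq0 k (w : 'I_4) : #|colorings (S :\ v) (remk L s k w)|%:R != 0 :> rat.
  by rewrite pnatr_eq0 -lt0n colorings_gt0 //; apply: list_ok_rem.
pose N0 : rat := #|colorings (S :\ v) L|%:R.
have prE (w : 'I_4) : #|colorings (S :\ v) (remk L s (size s) w)|%:R = N0 * pr w.
  suff H k : (k <= size s)%N -> #|colorings (S :\ v) (remk L s k w)|%:R =
      N0 * \prod_(m < k) (1 - PrS (S :\ v) (remk L s m w) (nth x0 s m) w).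
    exact: H.
  elim: k => [|k IH] ks.
    rewrite big_ord0 mulr1 /N0; congr _%:R; apply: eq_card => c.
    by apply/coloringsP/coloringsP => -[h1 h2 h3]; split=> // u /h1; rewrite /remk take0.
  rewrite big_ord_recr /= mulrA -IH 1?ltnW // /PrS mulrBr mulr1.
  by rewrite [_ * (_ / _)]mulrC divfK // -(@card_colorings_rem _ _ _ _ _ x0 us subS ks) natrD addrK.
have fE (w : 'I_4) : w \in L v -> #|fixed_colorings S L v w|%:R = N0 * pr w.
  by move=> wL; rewrite (@card_fixed_colorings _ _ _ s) // prE.
have -> : PrS S L v i = N0 * pr i / \sum_(w in L v) N0 * pr w.
  rewrite /PrS fE //; congr (_ / _).
  rewrite -(eq_bigr _ fE) -natr_sum; congr _%:R.
  rewrite -sum1_card (partition_big (fun c : {ffun T -> 'I_4} => c v) (mem (L v))) /=.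
    by apply: eq_bigr => w _; rewrite -sum1_card; apply: eq_bigl => c; rewrite !inE.
  by move=> c /coloringsP[h1 _ _]; apply: h1.
rewrite -mulr_sumr -mulf_div divff ?mul1r // /N0.
by rewrite pnatr_eq0 -lt0n colorings_gt0 //; apply: (@list_ok_rem S L v [::] 0 ord0).
Qed.

(** * Unfolding the procedure *)

(** The exact recursion, fed with values of the procedure at depth [D]. The factors f_j of the
    two-neighbour case are [onestep] at the first neighbour; [x0] is only a default for [nth]. *)
Definition onestep x0 D S L v : 'I_4 -> rat :=
  normalized (L v) (fun j => \prod_(k < size (nbrs S v))
    (1 - P D (S :\ v) (remk L (nbrs S v) k j) (nth x0 (nbrs S v) k) j)).

Lemma P_notin D S L v i : i \notin L v -> P D S L v i = 0.
Proof. by case: D => [|D] /= ->. Qed.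

Lemma P_isolated D S L v i :
  nbrs S v = [::] -> i \in L v -> P D S L v i = #|L v|%:R^-1.
Proof. by case: D => [|D] /= nb iL; rewrite iL ?nb. Qed.

Lemma P_deg1_card4 D S L v u i : nbrs S v = [:: u] -> i \in L v -> #|L v| = 4%N ->
  P D.+1 S L v i = (1 - P D (S :\ v) L u i) / 3.
Proof. by move=> /= -> -> ->. Qed.

Lemma P_deg1_card3 D S L v u i m :
  nbrs S v = [:: u] -> i \in L v -> ~: L v = [set m] ->
  P D.+1 S L v i = (1 - P D (S :\ v) L u i) / (2 + P D (S :\ v) L u m).
Proof.
move=> /= -> iL Lm; rewrite iL /=.
have -> : #|L v| = 3%N by have := cardsC (L v); rewrite Lm cards1 card_ord; nlia.
rewrite /= (_ : other _ i = m) // /other Lm; case: pickP => [j|/(_ m)].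
  by rewrite !inE => /andP[_ /eqP].
have : m \notin L v by rewrite -in_setC Lm set11.
by rewrite !inE eqxx andbT; case: eqP => // ->; rewrite iL.
Qed.

Lemma compl_card3 (A : {set 'I_4}) : #|A| = 3%N -> exists m, ~: A = [set m].
Proof.
by move=> A3; apply/cards1P/eqP; have := cardsC A; rewrite A3 card_ord; nlia.
Qed.

Lemma nbrs_nil S v : deg S v = 0%N -> nbrs S v = [::].
Proof. by rewrite -size_nbrs => /size0nil. Qed.

Lemma onestep_isolated x0 D S L v j : nbrs S v = [::] ->
  onestep x0 D S L v j = if j \in L v then #|L v|%:R^-1 else 0.
Proof.
move=> nb; rewrite /onestep nb /normalized; case: ifP => // _.
rewrite big_ord0 (eq_bigr (fun=> 1)); last by move=> w _; rewrite big_ord0.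
by rewrite sumr_const mul1r.
Qed.

Lemma onestep_deg1 x0 D S L v u : nbrs S v = [:: u] ->
  onestep x0 D S L v =1 normalized (L v) (fun j => 1 - P D (S :\ v) L u j).
Proof.
move=> nb j; rewrite /onestep nb; apply: eq_normalized => w.
by rewrite big_ord_recl big_ord0 mulr1.
Qed.

Lemma onestep_deg2 x0 D S L v a b : nbrs S v = [:: a; b] ->
  onestep x0 D S L v =1 normalized (L v) (fun j =>
    (1 - P D (S :\ v) L a j) * (1 - P D (S :\ v) (remk L [:: a; b] 1 j) b j)).
Proof.
move=> nb j; rewrite /onestep nb; apply: eq_normalized => w.
by rewrite big_ord_recl big_ord_recl big_ord0 mulr1.
Qed.

Lemma remk_pair1 L a b j : a != b -> remk L [:: a; b] 1 j b = L b.
Proof. by move=> ab; rewrite /remk /= inE eq_sym (negPf ab). Qed.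

(* The order of the two neighbours chosen by the procedure depends on the color
   only when both neighbours are leaves, where the formula is symmetric. *)
Lemma P_deg2 S L v a b : v \in S -> nbrs S v = [:: a; b] ->
  exists v1 v2, [/\ v1 != v2, [:: v1; v2] =i nbrs S v &
  forall D i, P D.+1 S L v i = normalized (L v) (fun j =>
    (1 - onestep v D (S :\ v) L v1 j) *
    (1 - P D (S :\ v) (remk L [:: v1; v2] 1 j) v2 j)) i].
Proof.
move=> vS nb.
have ab : a != b by have := nbrs_uniq S v; rewrite nb /= inE andbT.
have PE D i : i \in L v -> P D.+1 S L v i =
    normalized (L v) (fun j =>
    (1 - onestep v D (S :\ v) L (order2 e S L i a b).1 j) *
    (1 - P D (S :\ v) (remk L [:: (order2 e S L i a b).1; (order2 e S L i a b).2] 1 j)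
           (order2 e S L i a b).2 j)) i.
  by rewrite /= nb => iL; rewrite iL /= /normalized iL.
have ba : [:: b; a] =i nbrs S v by move=> u; rewrite nb !inE orbC.
case: (boolP ((deg S a == 1%N) && (deg S b == 1%N))) => [/andP[/eqP da /eqP db]|d1].
  exists a, b; split=> //; first by rewrite nb.
  move=> D i.
  have [iL|iL] := boolP (i \in L v); last by rewrite P_notin // /normalized (negPf iL).
  have isol u : u \in nbrs S v -> deg S u = 1%N -> nbrs (S :\ v) u = [::].
    rewrite mem_nbrs esym => /andP[_ euv] du; apply: nbrs_nil.
    by have := deg_rem S v u vS; rewrite du euv; nlia.
  have na : nbrs (S :\ v) a = [::] by apply: isol; rewrite ?nb ?inE ?eqxx.
  have nb' : nbrs (S :\ v) b = [::] by apply: isol; rewrite ?nb ?inE ?eqxx ?orbT.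
  have P_isol u j L' : nbrs (S :\ v) u = [::] ->
      P D (S :\ v) L' u j = if j \in L' u then #|L' u|%:R^-1 else 0.
    by move=> nu; case: ifPn => jL; [exact: P_isolated|exact: P_notin].
  rewrite PE // /order2 da db /=; case: ifP => // _; apply: eq_normalized => j /=.
  rewrite !onestep_isolated ?P_isol // !remk_pair1 // 1?eq_sym //.
  by rewrite mulrC.
case: (leqP (deg S b) (deg S a)) => dab.
  exists a, b; split=> //; first by rewrite nb.
  move=> D i; have [iL|iL] := boolP (i \in L v); last by rewrite P_notin // /normalized (negPf iL).
  by rewrite PE // /order2 dab (negPf d1).
exists b, a; split=> //; first by rewrite eq_sym.
move=> D i; have [iL|iL] := boolP (i \in L v); last by rewrite P_notin // /normalized (negPf iL).
by rewrite PE // /order2 leqNgt dab.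
Qed.

(** * Bounds valid at every depth *)

(** The invariant of the induction on depth. The sharper bound 1/6 at degree at most one serves the
    deficit estimate for triples with two neighbours. *)
Definition good S L v (f : 'I_4 -> rat) :=
  [/\ \sum_j f j = 1, forall j, 0 <= f j <= 1 / 2,
      forall j, j \in L v -> 1 / 13 <= f j
    & (deg S v <= 1)%N -> forall j, j \in L v -> 1 / 6 <= f j].

Lemma good_normalized S L v g : (0 < #|L v|)%N ->
  (forall j, j \in L v -> 1 / 13 <= normalized (L v) g j <= 1 / 2) ->
  ((deg S v <= 1)%N -> forall j, j \in L v -> 1 / 6 <= normalized (L v) g j) ->
  good S L v (normalized (L v) g).
Proof.
move=> L0 b1 b2; split=> //; last by move=> j /b1/andP[].
- apply: sum_normalized; apply/eqP => g0; case/card_gt0P: L0 => j jL.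
  by have := b1 j jL; rewrite /normalized jL g0 invr0 mulr0; lra.
- move=> j; have [/b1|jL] := boolP (j \in L v); first lra.
  by rewrite /normalized (negPf jL); lra.
Qed.

Lemma eq_good S L v f g : f =1 g -> good S L v g -> good S L v f.
Proof.
move=> fg [h1 h2 h3 h4]; split=> [|j|j|d j]; rewrite ?fg; auto.
by rewrite -h1; apply: eq_bigr => j _.
Qed.

Lemma good_uniform S L v f : (2 <= #|L v|)%N ->
  (forall j, f j = if j \in L v then #|L v|%:R^-1 else 0) -> good S L v f.
Proof.
move=> L2 fE; have L4 := card_list_le L v.
have b j : j \in L v -> 1 / 4 <= f j <= 1 / 2.
  move=> jL; rewrite fE jL; move: L2 L4.
  by case: #|_| => [|[|[|[|[|n]]]]] //.
split=> [|j|j jL|_ j jL].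
- rewrite (eq_bigr _ (fun j _ => fE j)) -big_mkcond sumr_const -(mulr_natr (_^-1)) mulVf //.
  by rewrite pnatr_eq0; nlia.
- by have [/b|/negPf jL] := boolP (j \in L v); rewrite ?fE ?jL; lra.
- by have := b j jL; lra.
- by have := b j jL; lra.
Qed.

Lemma cards4T (A : {set 'I_4}) : (4 <= #|A|)%N -> A = setT.
Proof. by move=> A4; apply/eqP; rewrite eqEcard subsetT cardsT card_ord. Qed.

Lemma good_deg1 S L v f : (3 <= #|L v|)%N ->
  \sum_j f j = 1 -> (forall j, 0 <= f j <= 1 / 2) ->
  good S L v (normalized (L v) (fun j => 1 - f j)).
Proof.
move=> L3 f1 f01; have b := normalized1_bounds (L v) f _ f01 f1 L3.
by apply: good_normalized => [|j /b|_ j /b]; [nlia|lra|lra].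
Qed.

(** Two neighbours force a full list, which is the setting of the two-factor bounds. *)
Lemma good_deg2 S L v f y : deg S v = 2%N -> (4 <= #|L v|)%N ->
  \sum_j f j = 1 -> (forall j, 0 <= f j <= 1 / 2) -> (forall j, 0 <= y j <= 1 / 2) ->
  good S L v (normalized (L v) (fun j => (1 - f j) * (1 - y j))).
Proof.
move=> d2 /[dup] L4 /cards4T LT f1 f01 y01.
have b j := normalized2_bounds (L v) f y j f01 y01 f1 LT.
by apply: good_normalized => [|j _|]; [nlia|exact: b|rewrite d2].
Qed.

Lemma onestep_good x0 D S L v :
  (forall S L v, reachable_in S L v -> good S L v (P D S L v)) ->
  reachable_in S L v -> good S L v (onestep x0 D S L v).
Proof.
move=> IH [ok vS d2 dL]; have := size_nbrs S v.
case nb: (nbrs S v) => [|a [|b [|? ?]]] //= dE; last by nlia.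
- by apply: good_uniform => [|j]; [nlia|exact: onestep_isolated].
- apply: eq_good (onestep_deg1 x0 D S L v a nb) _.
  have /IH[f1 f01 _ _] : reachable_in (S :\ v) L a.
    by apply: reachable_in_nbr => //; rewrite nb mem_head.
  by apply: good_deg1 => //; nlia.
- apply: eq_good (onestep_deg2 x0 D S L v a b nb) _.
  have /IH[f1 f01 _ _] : reachable_in (S :\ v) L a.
    by apply: reachable_in_nbr => //; rewrite nb mem_head.
  apply: good_deg2 => // [|j]; first by nlia.
  have /IH[_ + _ _] : reachable_in (S :\ v) (remk L [:: a; b] 1 j) b.
    by apply: (@reachable_in_rem S L v v [:: a; b] 1 j);
       rewrite -?nb ?nbrs_uniq ?nb.
  exact.
Qed.

(** Reachability leaves only lists of three or four colors at degree one. As the neighbour's values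
    sum to 1, the normalizing sum is 3 for four colors, and 2 plus the value of the missing color
    for three. *)
Lemma P_onestep x0 D S L v :
  (forall S L v, reachable_in S L v -> good S L v (P D S L v)) ->
  reachable_in S L v -> (deg S v <= 1)%N -> P D.+1 S L v =1 onestep x0 D S L v.
Proof.
move=> IH [ok vS _ dL]; rewrite -size_nbrs; case nb: (nbrs S v) => [|a [|? ?]] // _ j.
  rewrite onestep_isolated //; case: ifPn => jL; [exact: P_isolated|exact: P_notin].
rewrite (onestep_deg1 x0 D S L v a nb) /normalized.
case: ifPn => jL; last exact: P_notin.
have /IH[f1 _ _ _] : reachable_in (S :\ v) L a.
  by apply: reachable_in_nbr => //; rewrite nb mem_head.
have dE : deg S v = 1%N by rewrite -size_nbrs nb.
have sE : \sum_(w in L v) P D (S :\ v) L a w = 1 - \sum_(w in ~: L v) P D (S :\ v) L a w.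
  rewrite -f1 [in RHS](bigID (mem (L v))) /= [X in _ = _ + X - _](eq_bigl (mem (~: L v))) ?addrK //.
  by move=> w; rewrite !inE.
rewrite sum_compl_in sE.
have [L4|L3] : #|L v| = 4%N \/ #|L v| = 3%N by have := card_list_le L v; nlia.
  rewrite (P_deg1_card4 D S L v a) // L4 big1 ?subr0 // => w.
  by rewrite (cards4T (L v)) ?L4 // inE inE.
have [m Lm] := compl_card3 _ L3; rewrite (P_deg1_card3 D S L v a j m) // L3 Lm big_set1.
by congr (_ / _); lra.
Qed.

Lemma P_good D S L v : reachable_in S L v -> good S L v (P D S L v).
Proof.
elim: D S L v => [|D IH] S L v r; have [ok vS d2 dL] := r.
  by apply: good_uniform => [|j]; [nlia|rewrite /=; case: (j \in L v)].
have [d1|d1] := leqP (deg S v) 1.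
  exact: eq_good (P_onestep v D S L v IH r d1) (onestep_good v D S L v IH r).
have {d1}d2 : deg S v = 2%N by nlia.
case nb: (nbrs S v) (size_nbrs S v) => [|a [|b [|? ?]]]; rewrite d2 => // _.
have [v1 [v2 [v12 sN PE]]] := P_deg2 S L v a b vS nb.
apply: eq_good (PE D) _.
have [f1 f01 _ _] : good (S :\ v) L v1 (onestep v D (S :\ v) L v1).
  by apply: onestep_good => //; apply: reachable_in_nbr => //; rewrite -sN mem_head.
apply: good_deg2 => // [|j]; first by nlia.
have /IH[_ + _ _] : reachable_in (S :\ v) (remk L [:: v1; v2] 1 j) v2.
  apply: (@reachable_in_rem S L v v [:: v1; v2] 1 j) => //.
    by rewrite /= inE v12.
  by move=> u; rewrite sN.
exact.
Qed.

(** * Exactness at sufficient depth *)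

Lemma onestep_exact x0 D S L v i :
  (forall S L v i, (#|S| <= D)%N -> reachable_in S L v -> P D S L v i = PrS S L v i) ->
  (#|S| <= D.+1)%N -> list_ok S L -> v \in S ->
  onestep x0 D S L v i = PrS S L v i.
Proof.
move=> IH SD ok vS; rewrite /onestep /normalized.
case: ifPn => iL; last by rewrite PrS_notin.
rewrite (PrS_rec S L v x0 (nbrs S v)) // ?nbrs_uniq //.
have E (j : 'I_4) : \prod_(k < size (nbrs S v))
    (1 - P D (S :\ v) (remk L (nbrs S v) k j) (nth x0 (nbrs S v) k) j) =
  \prod_(k < size (nbrs S v))
    (1 - PrS (S :\ v) (remk L (nbrs S v) k j) (nth x0 (nbrs S v) k) j).
  apply: eq_bigr => k _; rewrite IH //; first by move: SD; rewrite (cardsD1 v) vS.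
  by apply: reachable_in_rem => //; rewrite nbrs_uniq.
by rewrite E; congr (_ / _); apply: eq_bigr.
Qed.

(** Each recursive call deletes at least one vertex, so the depth cutoff is never what determines
    the value. *)
Lemma P_exact D S L v i :
  (#|S| <= D)%N -> reachable_in S L v -> P D S L v i = PrS S L v i.
Proof.
elim: D S L v i => [|D IH] S L v i SD r; have [ok vS d2 dL] := r.
  by move: SD; rewrite leqn0 cards_eq0 => /eqP S0; rewrite S0 inE in vS.
have [d1|d1] := leqP (deg S v) 1.
  rewrite (P_onestep v D S L v _ r d1); last exact: P_good.
  exact: onestep_exact.
have {d1}d2 : deg S v = 2%N by nlia.
case nb: (nbrs S v) (size_nbrs S v) => [|a [|b [|? ?]]]; rewrite d2 => // _.
have [v1 [v2 [v12 sN PE]]] := P_deg2 S L v a b vS nb.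
rewrite PE /normalized; case: ifPn => iL; last by rewrite PrS_notin.
have us : uniq [:: v1; v2] by rewrite /= inE v12.
rewrite (PrS_rec S L v v [:: v1; v2]) //.
have SvD : (#|S :\ v| <= D)%N by move: SD; rewrite (cardsD1 v) vS.
have v1r : reachable_in (S :\ v) L v1 by apply: reachable_in_nbr => //; rewrite -sN mem_head.
have E (j : 'I_4) : (1 - onestep v D (S :\ v) L v1 j) *
    (1 - P D (S :\ v) (remk L [:: v1; v2] 1 j) v2 j) =
  \prod_(k < 2) (1 - PrS (S :\ v) (remk L [:: v1; v2] k j) (nth v [:: v1; v2] k) j).
  rewrite !big_ord_recl big_ord0 mulr1; congr (_ * (1 - _)).
    by case: v1r => ok1 v1S _ _; rewrite (onestep_exact v D) // ltnW.
  apply: IH => //; apply: (@reachable_in_rem S L v v [:: v1; v2] 1 j) => //.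
  by move=> u; rewrite sN.
by rewrite E; congr (_ / _); apply: eq_bigr.
Qed.

(** * The trichotomy *)

Lemma good_range S L v f j : good S L v f -> 0 <= f j <= 1 / 2.
Proof. by case. Qed.

Lemma good_ge S L v f j : good S L v f -> j \in L v -> 1 / 13 <= f j.
Proof. by case=> _ _ h _; apply: h. Qed.

Lemma compl_of_notin (A : {set 'I_4}) i : i \notin A -> (3 <= #|A|)%N -> ~: A = [set i].
Proof.
move=> iA A3; apply/eqP; rewrite eq_sym eqEcard sub1set inE iA cards1.
by have := cardsC A; rewrite card_ord; nlia.
Qed.

(** For three colors the value is (1 - x) / (2 + y). If [u] allows the missing color, y >= 1/13
    yields exactly 1 / (2 + 1/13) = 13/27; if it allows [i], x >= 1/13 yields 6/13. If it allows
    neither, x = y = 0. *)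
Lemma P_trichotomy_deg1 S L v u i : reachable_in S L v -> nbrs S v = [:: u] -> i \in L v ->
  (forall D, P D.+2 S L v i = 1 / 2) \/
  (forall D, 1 / 13 <= P D.+2 S L v i <= 13 / 27).
Proof.
move=> [ok vS _ dL] nb iL.
have ru : reachable_in (S :\ v) L u by apply: reachable_in_nbr => //; rewrite nb mem_head.
have g D := P_good D _ _ _ ru.
have dE : deg S v = 1%N by rewrite -size_nbrs nb.
have [L4|L3] : #|L v| = 4%N \/ #|L v| = 3%N by have := card_list_le L v; nlia.
  right=> D; rewrite (P_deg1_card4 _ _ _ _ u) //.
  by have := good_range _ _ _ _ i (g D.+1); lra.
have [m Lm] := compl_card3 _ L3.
have PE D : P D.+2 S L v i = (1 - P D.+1 (S :\ v) L u i) / (2 + P D.+1 (S :\ v) L u m).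
  by rewrite (P_deg1_card3 _ _ _ _ u _ m).
have [iu|iu] := boolP (i \in L u).
  right=> D; rewrite PE; have := good_ge _ _ _ _ _ (g D.+1) iu.
  have := good_range _ _ _ _ i (g D.+1); have := good_range _ _ _ _ m (g D.+1).
  by move=> *; rewrite ler_pdivlMr ?ler_pdivrMr; [apply/andP; split; lra|lra|lra].
have [mu|mu] := boolP (m \in L u).
  right=> D; rewrite PE; have := good_ge _ _ _ _ _ (g D.+1) mu.
  have := good_range _ _ _ _ i (g D.+1); have := good_range _ _ _ _ m (g D.+1).
  by move=> *; rewrite ler_pdivlMr ?ler_pdivrMr; [apply/andP; split; lra|lra|lra].
by left=> D; rewrite PE !P_notin // subr0 addr0.
Qed.

Lemma sum_mem_neq (A : {set 'I_4}) i :
  \sum_(j | j != i) (j \in A)%:R = #|A|%:R - (i \in A)%:R :> rat.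
Proof.
have -> : #|A|%:R = \sum_j (j \in A)%:R :> rat.
  by rewrite -natr_sum -sum1_card big_mkcond /=; congr _%:R; apply: eq_bigr => j _; case: (j \in A).
by rewrite [in RHS](bigD1 i) //= addrAC subrr add0r.
Qed.

(** Each summand equals (2x + z) / (2(2 + z)), increasing in x and z. The assignment [L'] may vary
    with [j], but not at [w], so the allowed colors of [w] are fixed. *)
Lemma deficit_ge S L i w (x z : 'I_4 -> rat) (L' : 'I_4 -> T -> {set 'I_4}) :
  (deg S w <= 2)%N -> (deg S w + 2 <= #|L w|)%N ->
  (forall j, L' j w = L w) ->
  (forall j, exists f, [/\ good S (L' j) w f, x j = f j & z j = f i]) ->
  2 / 13 <= \sum_(j | j != i) (1 / 2 - (1 - x j) / (2 + z j)).
Proof.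
move=> d2 dL LE H.
have x0 j : 0 <= x j by have [f [g -> _]] := H j; have := good_range _ _ _ _ j g; lra.
have z0 j : 0 <= z j by have [f [g _ ->]] := H j; have := good_range _ _ _ _ i g; lra.
have sumc (c : rat) : \sum_(j | j != i) c = 3 * c.
  by rewrite sumr_const cardC1 card_ord -[c *+ _]mulr_natl.
have [d1|d1] := leqP (deg S w) 1.
  (* With allowed values at least 1/6, (2x + z) / (2(2 + z)) is at least 2/26, 1/26 or 3/26 when [w]
     allows only [j], only [i], or both. Summing gives at least 2 [#|L w|] / 26. *)
  suff le j : (2 * (j \in L w)%:R + (i \in L w)%:R) / 26 <= 1 / 2 - (1 - x j) / (2 + z j).
    apply: le_trans (ler_sum _ (fun j _ => le j)).
    rewrite -mulr_suml big_split /= -mulr_sumr sum_mem_neq sumc.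
    have : 2 <= #|L w|%:R :> rat by rewrite (ler_nat _ 2); nlia.
    by case: (i \in L w) => /=; lra.
  rewrite lerBrDl -lerBrDr ler_pdivrMr; last by have := z0 j; lra.
  have [f [[_ _ _ /(_ d1) g] xE zE]] := H j; rewrite LE in g.
  have xj : j \in L w -> 1 / 6 <= x j by rewrite xE; apply: g.
  have zj : i \in L w -> 1 / 6 <= z j by rewrite zE; apply: g.
  have := x0 j; have := z0 j; move: xj zj.
  by case: (j \in L w); case: (i \in L w) => /= xj zj *;
    try (have {}xj := xj isT); try (have {}zj := zj isT); lra.
have LT : L w = setT by apply: cards4T; nlia.
suff le j : 1 / 18 <= 1 / 2 - (1 - x j) / (2 + z j).
  by apply: le_trans (ler_sum _ (fun j _ => le j)); rewrite sumc; lra.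
rewrite lerBrDl -lerBrDr ler_pdivrMr; last by have := z0 j; lra.
have [f [g xE zE]] := H j.
have : 1 / 13 <= x j by rewrite xE; apply: good_ge g _; rewrite LE LT inE.
have : 1 / 13 <= z j by rewrite zE; apply: good_ge g _; rewrite LE LT inE.
by lra.
Qed.

(** If a neighbour allows [i], then [f i] or [y i] is at least 1/13. Otherwise both neighbours have
    at most three colors, hence at most one neighbour each besides [v], and only a triangle avoids a
    deficit of 2/13. *)
Lemma P_trichotomy_deg2 S L v a b i : reachable_in S L v -> nbrs S v = [:: a; b] ->
  (forall D, P D.+2 S L v i = 1 / 2) \/
  (forall D, 1 / 13 <= P D.+2 S L v i <= 13 / 27).
Proof.
move=> [ok vS _ dL] nb.
have [v1 [v2 [v12 sN PE]]] := P_deg2 S L v a b vS nb.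
have dE : deg S v = 2%N by rewrite -size_nbrs nb.
have LT : L v = setT by apply: cards4T; nlia.
have sub : {subset [:: v1; v2] <= nbrs S v} by move=> u; rewrite sN.
have r1 : reachable_in (S :\ v) L v1 by apply: reachable_in_nbr => //; rewrite -sN mem_head.
have r2 j : reachable_in (S :\ v) (remk L [:: v1; v2] 1 j) v2.
  apply: (@reachable_in_rem S L v v [:: v1; v2] 1 j) => //.
  by rewrite /= inE v12.
have L2 j : remk L [:: v1; v2] 1 j v2 = L v2 by exact: remk_pair1.
have gf D := onestep_good v D _ _ _ (P_good D) r1.
have gy D j := P_good D _ _ _ (r2 j).
have f1 D : \sum_j onestep v D (S :\ v) L v1 j = 1 by case: (gf D).
have f01 D j := good_range _ _ _ _ j (gf D).
have y01 D j := good_range _ _ _ _ j (gy D j).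
have suff_range : (forall D,
    let y j := P D.+1 (S :\ v) (remk L [:: v1; v2] 1 j) v2 j in
    [\/ 1 / 13 <= onestep v D.+1 (S :\ v) L v1 i, 1 / 13 <= y i |
      2 / 13 <= \sum_(j | j != i) (1 / 2 - y j)]) ->
    forall D, 1 / 13 <= P D.+2 S L v i <= 13 / 27.
  move=> H D; rewrite PE; apply/andP; split.
    by case/andP: (normalized2_bounds _ _ _ i (f01 D.+1) (y01 D.+1) (f1 D.+1) LT).
  by apply: normalized2_le => //; apply: H.
have [i1|i1] := boolP (i \in L v1).
  by right; apply: suff_range => D; apply: Or31; apply: good_ge (gf _) i1.
have [i2|i2] := boolP (i \in L v2).
  by right; apply: suff_range => D y; apply: Or32; apply: good_ge (gy _ _) _; rewrite L2.
have [_ _ _ dv1] := r1; have [_ v2S dv2' dv2] := r2 i; rewrite L2 in dv2.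
have lt4 u : i \notin L u -> (#|L u| <= 3)%N.
  move=> iu; rewrite -ltnS ltn_neqAle; have := cardsC (L u); rewrite card_ord.
  have : (0 < #|~: L u|)%N by apply/card_gt0P; exists i; rewrite inE.
  by nlia.
have {lt4} [c1 c2] := (lt4 _ i1, lt4 _ i2).
case nb2: (nbrs (S :\ v) v2) (size_nbrs (S :\ v) v2) => [|w [|? ?]] de2;
  rewrite /= in de2; last by nlia.
  right; apply: suff_range => D y; apply: Or33; rewrite sumrB.
  (* Cutting the list of [v1] does not affect the isolated [v2], so [y] is one distribution with
     [y i] = 0; its deficit is 3/2 - 1 = 1/2. *)
  have yE j : y j = if j \in L v2 then #|L v2|%:R^-1 else 0.
    rewrite /y; case: ifPn => jL; last by rewrite P_notin ?L2.
    by rewrite P_isolated ?L2.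
  have [|s1 y0 _ _] := good_uniform (S :\ v) L v2 y _ yE; first by nlia.
  have c : \sum_(j | j != i) (1 / 2) = 3 / 2 :> rat.
    by rewrite sumr_const cardC1 card_ord.
  move: s1; rewrite c (bigD1 i) //=.
  by have := y0 i; lra.
have m2 : ~: L v2 = [set i] by apply: compl_of_notin => //; nlia.
have yE D j : j != i -> P D.+1 (S :\ v) (remk L [:: v1; v2] 1 j) v2 j =
    (1 - P D (S :\ v :\ v2) (remk L [:: v1; v2] 1 j) w j) /
    (2 + P D (S :\ v :\ v2) (remk L [:: v1; v2] 1 j) w i).
  move=> ji; rewrite (P_deg1_card3 _ _ _ _ w _ i) // L2 //.
  by rewrite -[L v2]setCK m2 !inE.
have wN : w \in nbrs (S :\ v) v2 by rewrite nb2 mem_head.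
have [wv1|wv1] := eqVneq w v1; last first.
  right; apply: suff_range => D y; apply: Or33.
  rewrite (eq_bigr _ (fun j ji => congr1 (fun t => 1 / 2 - t) (yE D j ji))).
  have rw j : reachable_in (S :\ v :\ v2) (remk L [:: v1; v2] 1 j) w.
    by have [ok2 ? _ _] := r2 j; apply: reachable_in_nbr.
  have Lw j : remk L [:: v1; v2] 1 j w = L w by rewrite /remk /= inE (negPf wv1).
  have [_ _ dw dLw] := rw i; rewrite Lw in dLw.
  apply: (deficit_ge (S :\ v :\ v2) L i w
    (fun j => P D (S :\ v :\ v2) (remk L [:: v1; v2] 1 j) w j)
    (fun j => P D (S :\ v :\ v2) (remk L [:: v1; v2] 1 j) w i)
    (fun j => remk L [:: v1; v2] 1 j)) => // j.
  by exists (P D (S :\ v :\ v2) (remk L [:: v1; v2] 1 j) w); split=> //; apply: P_good.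
(* Triangle: [v1] and [v2] both miss exactly [i]. The weight of [i] is 1, and each other color has
   weight (1 - 1/3)(1 - 1/2) = 1/3. *)
left=> D; subst w.
have v2N : v2 \in nbrs (S :\ v) v1.
  by move: wN; rewrite !mem_nbrs esym => /andP[_ ->]; rewrite v2S.
have nb1 : nbrs (S :\ v) v1 = [:: v2].
  case: (nbrs _ _) v2N (size_nbrs (S :\ v) v1) => [|u [|? ?]] //= v2N dv.
    by move: v2N; rewrite inE => /eqP->.
  by nlia.
have m1 : ~: L v1 = [set i].
  have d11 : deg (S :\ v) v1 = 1%N by rewrite -size_nbrs nb1.
  by apply: compl_of_notin => //; nlia.
have fE j : j != i -> onestep v D.+1 (S :\ v) L v1 j = 1 / 3.
  move=> ji; rewrite (onestep_deg1 _ _ _ _ _ v2) // /normalized.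
  have L12 : L v1 = L v2 by apply: setC_inj; rewrite m1 m2.
  have isol : nbrs (S :\ v :\ v1) v2 = [::].
    have v1S : v1 \in S :\ v by case: r1.
    apply: nbrs_nil; have := deg_rem (S :\ v) v1 v2 v1S.
    by move: wN; rewrite mem_nbrs => /andP[_ ->]; nlia.
  have card2 : #|L v2| = 3%N by nlia.
  have third k : k \in L v1 -> 1 - P D.+1 (S :\ v :\ v1) L v2 k = 2 / 3.
    by rewrite L12 => kL; rewrite P_isolated // card2; lra.
  have jL : j \in L v1 by rewrite -[L v1]setCK m1 !inE.
  by rewrite jL third // (eq_bigr _ third) sumr_const L12 card2.
rewrite PE /normalized LT inE (eq_bigl predT) => [|j]; last by rewrite inE.
rewrite (bigD1 i) // (eq_bigr (fun=> 1 / 3)) => [|j ji].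
  have fi : onestep v D.+1 (S :\ v) L v1 i = 0 by rewrite /onestep /normalized (negPf i1).
  by rewrite fi P_notin ?L2 // sumr_const cardC1 card_ord.
(* Here [v1] has lost color [j] and never allowed [i], so both values entering [yE] vanish and y_j =
   1/2. This unfolding of [v2] needs depth two; one level less would return 1/3. *)
have L1 k : remk L [:: v1; v2] 1 k v1 = L v1 :\ k by rewrite /remk /= mem_head.
by rewrite fE // yE // !P_notin ?L1 ?inE ?eqxx ?(negPf i1) ?andbF //; lra.
Qed.

Lemma P_trichotomy S L v i : reachable_in S L v ->
  [\/ forall D, P D.+2 S L v i = 0, forall D, P D.+2 S L v i = 1 / 2
    | forall D, 1 / 13 <= P D.+2 S L v i <= 13 / 27].
Proof.
move=> r; have [ok vS d2 dL] := r.
have [iL|iL] := boolP (i \in L v); last by apply: Or31 => D; apply: P_notin.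
case nb: (nbrs S v) (size_nbrs S v) => [|a [|b [|? ?]]] dE;
  rewrite /= in dE; last by nlia.
- have L4 := card_list_le L v; have L2 : (2 <= #|L v|)%N by nlia.
  have [L2'|L3] : #|L v| = 2%N \/ (3 <= #|L v|)%N by nlia.
    by apply: Or32 => D; rewrite P_isolated // L2'.
  apply: Or33 => D; rewrite P_isolated //; move: L3 L4.
  by case: #|_| => [|[|[|[|[|n]]]]].
- by have [H|H] := P_trichotomy_deg1 S L v a i r nb iL; [apply: Or32|apply: Or33].
- by have [H|H] := P_trichotomy_deg2 S L v a b i r nb; [apply: Or32|apply: Or33].
Qed.

End Procedure.

Theorem theorem12 (T : finType) (e : rel T) (L : T -> {set 'I_4}) (v : T)
    (i : 'I_4) (D : nat) :
  symmetric e -> irreflexive e ->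
  reachable e L v -> (2 <= D)%N ->
  (P e D setT L v i = 0 <-> Pr e L v i = 0) /\
  (P e D setT L v i = 1 / 2 <-> Pr e L v i = 1 / 2) /\
  (1 / 13 <= P e D setT L v i <= 13 / 27 <->
     1 / 13 <= Pr e L v i <= 13 / 27).
Proof.
move=> esym eirr [ok [d2 dL]] D2.
have r : @reachable_in T e setT L v.
  by split=> // u _; have [? ?] := ok u; split=> //; nlia.
(* The probability is itself an output at a depth of at least 2, so the trichotomy covers both sides
   of each equivalence. *)
have PrE : Pr e L v i = P e #|T|.+2 setT L v i.
  by rewrite (P_exact esym eirr) ?PrST // cardsT -addn2 leq_addr.
have -> : D = (D - 2).+2 by nlia.
rewrite PrE; case: (P_trichotomy esym eirr _ _ _ i r) => H; rewrite !H //.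
(* Since 0 < 1/13 and 13/27 < 1/2, membership in the interval excludes 0 and 1/2 on both sides. *)
- by have := H (D - 2)%N; have := H #|T|; lra.
Qed.
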